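(* Let $\Gamma$ be a metric graph, let $r\ge 0$ be an integer, let $D$ be a divisor on $\Gamma$ and let $\mathfrak S$ be a slope structure of width $r$ on $\Gamma$. Let $M\subseteq \mathrm{Rat}(D,\mathfrak S)$ be an admissible semimodule of rank $r$ with underlying slope structure $\mathfrak S$. Let $v$ be a point of $\Gamma$ and let $\underline a$ be a jump of the rank function $\rho_v$. Then there exists $f\in M$ such that $\partial_v(f)=s_{\underline a}$.
   Context: Metric graphs. A metric graph $\Gamma$ is the metric realization of a pair $(G,\ell)$, where $G=(V,E)$ is a finite connected graph with at least one edge and $\ell\colon E\to\mathbb R_{>0}$: each edge $e$ is replaced by a closed interval of length $\ell(e)$, glued according to $G$, with the path metric. $G$ (with $\ell$) is called a model of $\Gamma$; a model is simple if it has no loops and no parallel edges. $\mathrm T_x(\Gamma)$ is the finite set of outgoing unit tangent vectors at $x$, and $d_x=|\mathrm T_x(\Gamma)|$. $\mathrm{Rat}(\Gamma)$ is the set of continuous piecewise affine functions $f\colon\Gamma\to\mathbb R$ with integral slopes; $\mathrm{slope}_\nu(f)$ is the outgoing slope of $f$ along $\nu$. A divisor $D$ is a finite formal integer combination of points of $\Gamma$, $D(x)$ is its coefficient at $x$, $D\ge 0$ (effective) means all coefficients are $\geq 0$. $\mathrm{div}(f)=\sum_x \mathrm{ord}_x(f)(x)$ with $\mathrm{ord}_x(f)=-\sum_{\nu\in \mathrm T_x(\Gamma)}\mathrm{slope}_\nu(f)$. $\mathrm{Rat}(D)=\{f\in\mathrm{Rat}(\Gamma): D+\mathrm{div}(f)\ge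 0\}$. Hypercube rank functions. Put $[r]=\{0,\dots,r\}$. The hypercube $[r]^\delta$ ($\delta\geq 1$) carries the coordinatewise order $\preceq$ and coordinatewise max $\vee$ and min $\wedge$; $\underline e_i$ is the $i$-th unit vector. A rank function is a map $\rho\colon[r]^\delta\to\mathbb Z$ such that: (1) $\rho(t\,\underline e_i)=r-t$ for all $i$ and $t\in[r]$; (2) $\underline a\preceq\underline b$ implies $\rho(\underline b)\le\rho(\underline a)$; (3) $\rho(\underline a)+\rho(\underline b)\le\rho(\underline a\vee\underline b)+\rho(\underline a\wedge\underline b)$; (4) $\rho$ takes values in $\{-1,0,\dots,r\}$. A jump of $\rho$ is a point $\underline a$ with $\rho(\underline a)\ge 0$ and $\rho(\underline a+\underline e_i)=\rho(\underline a)-1$ for every $i$ with $\underline a+\underline e_i\in[r]^\delta$. The standard rank function is $\rho(\underline a)=\max\{-1,r-a_1-\dots-a_\delta\}$. Slope structures. A slope structure $\mathfrak S$ of width $r$ on $\Gamma$ is the data, on some simple graph model $G=(V,E)$ of $\Gamma$, of: for every oriented edge $uv$, a set $S^{uv}$ of integers $s_0^{uv}<\dots<s_r^{uv}$ with $s_i^{uv}+s_{r-i}^{vu}=0$; for every $v\in V$, a rank function $\rho_v$ on $[r]^{d_v}$, whose coordinates are indexed by the oriented edges with tail $v$ (equivalently by $\mathrm T_v(\Gamma)$). It is extended to all of $\Gamma$: for $\nu\in \mathrm T_x(\Gamma)$, $S^\nu=\{s_0^\nu<\dots<s_r^\nu\}$ is $S^{uv}$ for the oriented edge $uv$ parallel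 to $\nu$; for $x\in\Gamma\setminus V$, $\rho_x$ is the standard rank function on $[r]^2$. For $\underline a=(a_\nu)_\nu\in[r]^{\mathrm T_x(\Gamma)}$ put $s_{\underline a}=(s^\nu_{a_\nu})_\nu$, and let $S^x=\{s_{\underline a}:\underline a\text{ a jump of }\rho_x\}$. A function $f\in\mathrm{Rat}(\Gamma)$ is compatible with $\mathfrak S$ if for every $x\in\Gamma$, $\mathrm{slope}_\nu(f)\in S^\nu$ for all $\nu\in\mathrm T_x(\Gamma)$, and $\partial_x(f):=(\mathrm{slope}_\nu(f))_{\nu\in \mathrm T_x(\Gamma)}\in S^x$. If $\partial_x(f)=s_{\underline a}$, write $\rho_x(\partial_x(f)):=\rho_x(\underline a)$. $\mathrm{Rat}(D,\mathfrak S)$ is the set of $f\in\mathrm{Rat}(D)$ compatible with $\mathfrak S$. Admissible semimodules. A semimodule is a subset of $\mathrm{Rat}(\Gamma)$ stable under $(f,g)\mapsto\min(f,g)$ and $f\mapsto f+c$, $c\in\mathbb R$. A semimodule $M\subseteq\mathrm{Rat}(D)$ is admissible of rank $r$, with underlying slope structure $\mathfrak S$, if it is closed for the topology of $\|\cdot\|_\infty$, $\mathfrak S$ is a slope structure of width $r$ with $M\subseteq\mathrm{Rat}(D,\mathfrak S)$, and for every effective divisor $E$ of degree $r$ there is $f\in M$ with $\rho_x(\partial_x(f))\ge E(x)$ for all $x\in\Gamma$ and $D+\mathrm{div}(f)-E\ge 0$. *)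

(* Defs.v *)
From HB Require Import structures.
From mathcomp Require Import all_boot all_order all_algebra finmap.
From mathcomp Require Import all_classical all_reals.

Set Implicit Arguments.
Unset Strict Implicit.
Unset Printing Implicit Defensive.

Import Order.TTheory GRing.Theory Num.Theory.

Local Open Scope classical_set_scope.
Local Open Scope ring_scope.

(** * Metric graphs *)

(* A metric graph is presented by a model [(G, len)] and is its realization
   [gpoint].  Only the arc-length coordinates on the edges enter below, through
   slopes and piecewise affine functions.  Loops and parallel edges are allowed
   here.  A slope structure comes with a simple model of the metric graph, and
   it is this model that presents the metric graph in its presence: hence the
   field [ss_simple] below.  Every metric graph has a simple model. *)
Record metric_graph (R : realType) := MetricGraph {
  vertex : finType;
  edge : finType;
  src : edge -> vertex;
  tgt : edge -> vertex;
  len : edge -> R;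
  len_gt0 : forall e, 0 < len e;
  graph_connected : forall u v : vertex,
    connect (fun x y => [exists e, ((src e == x) && (tgt e == y))
                                || ((src e == y) && (tgt e == x))]) u v;
  has_edge : (0 < #|edge|)%N
}.

Definition is_simple (R : realType) (G : metric_graph R) : Prop :=
  (forall e : edge G, src e != tgt e) /\
  (forall e e' : edge G,
     (src e == src e') && (tgt e == tgt e')
     || (src e == tgt e') && (tgt e == src e') -> e = e').

Section Realization.
Variables (R : realType) (G : metric_graph R).

(* [(e, t)] with [0 < t < len e] is the point in the interior of [e] at
   distance [t] from [src e] along [e]. *)
Definition gpoint : choiceType :=
  (vertex G + {p : edge G * R | 0 < p.2 < len p.1})%type.

(* [(e, false)] is [e] oriented from [src e] to [tgt e]; [(e, true)] is the
   opposite orientation.  A loop has two distinct orientations. *)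
Definition oedge : finType := (edge G * bool)%type.

Definition tail (h : oedge) : vertex G := if h.2 then tgt h.1 else src h.1.

Definition opposite (h : oedge) : oedge := (h.1, ~~ h.2).

(* Arc-length parametrization of the closed edge [e], for [0 <= t <= len e]
   (constant outside of this interval). *)
Definition on_edge (e : edge G) (t : R) : gpoint :=
  if t <= 0 then inl (src e)
  else if insub (e, t) is Some p then inr p
  else inl (tgt e).

(* An outgoing unit tangent vector at [x] is encoded by the oriented edge that
   it is parallel to; thus an interior point has two tangent vectors, and a loop
   at a vertex contributes two of them. *)
Definition tangent_set (x : gpoint) : {set oedge} :=
  match x with
  | inl v => [set h | tail h == v]%SET
  | inr p => [set h | h.1 == (val p).1]%SET
  end.

Definition tangent (x : gpoint) : finType := {h : oedge | h \in tangent_set x}.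

(* The point at distance [s] from [x] in the direction [nu], for [s >= 0]
   small. *)
Definition move (x : gpoint) (nu : tangent x) (s : R) : gpoint :=
  let: (e, b) := val nu in
  let t0 := match x with
            | inl _ => if b then len e else 0
            | inr p => (val p).2
            end in
  on_edge e (if b then t0 - s else t0 + s).

(** * Rational functions and divisors *)

(* Being affine on the closed intervals of a finite subdivision of each closed
   edge includes the continuity of [f], also at the vertices. *)
Definition RatG : set (gpoint -> R) :=
  [set f | forall e : edge G,
     exists (n : nat) (t : nat -> R) (m : nat -> int),
       [/\ t 0%N = 0, t n = len e,
           forall i, (i < n)%N -> t i < t i.+1
         & forall i, (i < n)%N -> forall s, t i <= s <= t i.+1 ->
             f (on_edge e s) = f (on_edge e (t i)) + (m i)%:~R * (s - t i)]].

(* For [f] in [RatG] there is exactly one such integer [m]. *)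
Definition slope (f : gpoint -> R) (x : gpoint) (nu : tangent x) : int :=
  xget 0 [set m : int | exists2 eps : R, 0 < eps &
    forall s, 0 <= s <= eps -> f (move nu s) = f x + m%:~R * s].

Definition slopes (f : gpoint -> R) (x : gpoint) : {ffun tangent x -> int} :=
  [ffun nu => slope f nu].

Definition divisor := {fsfun gpoint -> int with 0}.

Definition deg (E : divisor) : int := \sum_(x <- finsupp E) E x.

Definition effective (E : divisor) : Prop := forall x, 0 <= E x.

(* The coefficient of [div f] at [x]. *)
Definition ord (f : gpoint -> R) (x : gpoint) : int :=
  - \sum_(nu : tangent x) slope f nu.

Definition RatD (D : divisor) : set (gpoint -> R) :=
  [set f | RatG f /\ forall x, 0 <= D x + ord f x].

End Realization.

(** * Rank functions on hypercubes *)

Section RankFunctions.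
Variables (r : nat) (I : finType).

(* The hypercube [r]^I; for a hypercube [r]^delta take [#|I| = delta]. *)
Definition cube : finType := {ffun I -> 'I_r.+1}.

Implicit Types (a b : cube) (rho : cube -> int).

Definition upd a (i : I) (t : 'I_r.+1) : cube :=
  [ffun j => if j == i then t else a j].

Definition origin : cube := [ffun => ord0].

Definition cube_le a b : Prop := forall i, (a i <= b i)%N.

Definition cube_max a b : cube := [ffun i => Order.max (a i) (b i)].

Definition cube_min a b : cube := [ffun i => Order.min (a i) (b i)].

Definition rank_function rho : Prop :=
  [/\ forall (i : I) (t : 'I_r.+1), rho (upd origin i t) = r%:Z - t%:Z,
      forall a b, cube_le a b -> rho b <= rho a,
      forall a b, rho a + rho b <= rho (cube_max a b) + rho (cube_min a b)
    & forall a, -1 <= rho a <= r%:Z].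

(* [upd a i t] with [t = a i + 1] is [a + e_i]; there is no such [t : 'I_r.+1]
   when [a + e_i] is outside of the hypercube. *)
Definition jump rho a : Prop :=
  0 <= rho a /\
  forall (i : I) (t : 'I_r.+1), t = (a i).+1 :> nat ->
    rho (upd a i t) = rho a - 1.

Definition standard_rank a : int :=
  Num.max (-1) (r%:Z - \sum_(i : I) (a i)%:Z).

End RankFunctions.

(** * Slope structures *)

(* The set [S^h] is given by its increasing enumeration
   [s_0^h < ... < s_r^h]. *)
Record slope_structure (R : realType) (G : metric_graph R) (r : nat) :=
  SlopeStructure {
  ss_simple : is_simple G;
  ss_slope : oedge G -> 'I_r.+1 -> int;
  ss_slope_incr : forall (h : oedge G) (i j : 'I_r.+1),
    (i < j)%N -> ss_slope h i < ss_slope h j;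
  ss_slope_opposite : forall (h : oedge G) (i : 'I_r.+1),
    ss_slope h i + ss_slope (opposite h) (rev_ord i) = 0;
  ss_rank : forall v : vertex G, cube r (tangent (inl v : gpoint G)) -> int;
  ss_rankP : forall v : vertex G, rank_function (@ss_rank v)
}.

Section Compatibility.
Variables (R : realType) (G : metric_graph R) (r : nat).
Variable S : slope_structure G r.

Definition rank_at (x : gpoint G) : cube r (tangent x) -> int :=
  match x with
  | inl v => @ss_rank _ _ _ S v
  | inr p => @standard_rank r (tangent (inr p : gpoint G))
  end.

Definition slope_vector (x : gpoint G) (a : cube r (tangent x)) :
    {ffun tangent x -> int} :=
  [ffun nu => ss_slope S (val nu) (a nu)].

Definition jump_slopes (x : gpoint G) : set {ffun tangent x -> int} :=
  [set slope_vector a | a in jump (@rank_at x)].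

Definition compatible (f : gpoint G -> R) : Prop :=
  RatG f /\ forall x : gpoint G,
    (forall nu : tangent x, exists i, slope f nu = ss_slope S (val nu) i) /\
    jump_slopes (slopes f x).

(* The index [a] with [slope_vector a = d] is unique if it exists, because the
   enumerations [ss_slope] are increasing. *)
Definition slope_rank (x : gpoint G) (d : {ffun tangent x -> int}) : int :=
  rank_at (xget (origin r (tangent x)) [set a | slope_vector a = d]).

Definition RatDS (D : divisor G) : set (gpoint G -> R) :=
  [set f | RatD D f /\ compatible f].

(** * Admissible semimodules *)

Definition semimodule (M : set (gpoint G -> R)) : Prop :=
  [/\ M `<=` @RatG R G,
      forall f g, M f -> M g -> M (fun x => Num.min (f x) (g x))
    & forall f (c : R), M f -> M (fun x => f x + c)].

(* [M] is closed in [RatG] for the sup norm. *)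
Definition sup_closed (M : set (gpoint G -> R)) : Prop :=
  forall f, RatG f ->
    (forall eps : R, 0 < eps ->
       exists2 g, M g & forall x, `|f x - g x| <= eps) ->
    M f.

Definition admissible (D : divisor G) (M : set (gpoint G -> R)) : Prop :=
  [/\ semimodule M, M `<=` RatD D, sup_closed M, M `<=` RatDS D
    & forall E : divisor G, effective E -> deg E = r%:Z ->
        exists2 f, M f &
          (forall x, E x <= slope_rank (slopes f x)) /\
          (forall x, 0 <= D x + ord f x - E x)].

End Compatibility.

(* Main.v *)
Require Import Defs.
From mathcomp Require Import all_boot all_order all_algebra finmap.
From mathcomp Require Import all_classical all_reals.
From mathcomp Require Import topology normedtype.
From mathcomp Require Import zify ring lra.

Set Implicit Arguments.
Unset Strict Implicit.
Unset Printing Implicit Defensive.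

Import Order.TTheory GRing.Theory Num.Theory.
Import numFieldNormedType.Exports.
Local Open Scope classical_set_scope.
Local Open Scope ring_scope.

(** The slopes of a compatible function along an oriented edge [h] belong to
    [s_0 < ... < s_r], and at an interior point the standard rank function
    forces their index to drop by at least the rank.  Hence a compatible
    function is concave on each edge, with at most [r] breakpoints counted with
    multiplicity, and the index of its slope at a point in a given direction is
    lower semicontinuous: if [g] is close enough to [f] in the supremum norm,
    then the indices of the slopes of [f] at [x] are at most those of [g]
    ([slope_index_le]).  Up to additive constants, these functions form a
    compact set, so that sequences in [M] have limit points in [M]
    ([admissible_compact]).

    An effective divisor [E] of degree [r] controls the jump [a] of [rho_v] if
    [E v = rho_v a] and every [f] in [M] with [E x <= rho_x (slopes f x)] for
    all [x] has the slopes [s_a] at [v].  As [M] has rank [r], it suffices to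
    find a divisor which controls [a]; this is done by descending induction on
    [rho_v a].  If [rho_v a = r], then [r] times the point [v] works.
    Otherwise there are a jump [b <= a] of rank [rho_v a + 1] and a direction
    [nu] with [b nu < a nu] ([jump_pred]).  Take [E] controlling [b], and let
    [E_n = E - v + y_n], where [y_n] tends to [v] in the direction [nu].  If no
    [E_n] controls [a], choose [g_n] in [M] refuting it, and let [f] in [M] be
    a limit point of the [g_n].  For suitable [n], semicontinuity gives
    [a_f <= a_g] between the indices of [f] and of [g_n] at [v], and strictly so
    along [nu] because of the index drop of [g_n] at [y_n].  As both are jumps,
    the rank at [v] of [f] exceeds that of [g_n], so that [f] satisfies the
    inequalities of [E].  Thus [a_f = b], and [a_g] is a jump above [b + e_nu]
    of rank at least [rho_v a].  By supermodularity [a] is the only such jump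
    ([jump_uniq]), contradicting the choice of [g_n]. *)

(** * Rank functions on hypercubes *)

Section RankFunctionTheory.
Variables (r : nat) (I : finType).
Implicit Types (a b : cube r I) (i : I) (t : 'I_r.+1).

Lemma updE a i t j : upd a i t j = if j == i then t else a j.
Proof. by rewrite ffunE. Qed.

Lemma cube_maxE a b i : cube_max a b i = maxn (a i) (b i) :> nat.
Proof. by rewrite ffunE /Order.max ltEord /maxn; case: ifP. Qed.

Lemma cube_minE a b i : cube_min a b i = minn (a i) (b i) :> nat.
Proof. by rewrite ffunE /Order.min ltEord /minn; case: ifP. Qed.

Lemma cubeP a b : (forall i, a i = b i :> nat) -> a = b.
Proof. by move=> ab; apply/ffunP => i; apply: val_inj; apply: ab. Qed.

Lemma cube_le_anti a b : cube_le a b -> cube_le b a -> a = b.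
Proof.
by move=> ab ba; apply: cubeP => i; apply/eqP; rewrite eqn_leq ab ba.
Qed.

Lemma cube_le_neq a b : cube_le a b -> a <> b -> exists i, (a i < b i)%N.
Proof.
move=> ab neq; apply: contrapT => nlt; apply: neq; apply: cube_le_anti => // i.
by rewrite leqNgt; apply/negP => lt_i; apply: nlt; exists i.
Qed.

Lemma upd_le a b i t : cube_le a b -> (t <= b i)%N -> cube_le (upd a i t) b.
Proof. by move=> ab tb j; rewrite updE; case: eqP => [->|_]. Qed.

Variable rho : cube r I -> int.
Hypothesis rhoP : rank_function rho.

Lemma rank_le a b : cube_le a b -> rho b <= rho a.
Proof. by case: rhoP => _ + _ _; apply. Qed.

Lemma rank_max_min a b :
  rho a + rho b <= rho (cube_max a b) + rho (cube_min a b).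
Proof. by case: rhoP. Qed.

Lemma rank_le_width a : rho a <= r%:Z.
Proof. by case: rhoP => _ _ _ /(_ a)/andP[]. Qed.

(** Unit steps on the axes propagate to unit steps everywhere, by
    supermodularity applied to [a] and to the point [t e_i] of the axis. *)
Lemma rank_upd_ge a i t : t = (a i).+1 :> nat -> rho a - 1 <= rho (upd a i t).
Proof.
move=> tE; have [axis _ _ _] := rhoP.
have := rank_max_min a (upd (origin r I) i t).
have -> : cube_max a (upd (origin r I) i t) = upd a i t.
  apply: cubeP => j; rewrite cube_maxE !updE ffunE.
  by case: eqP => [->|_] /=; rewrite ?maxn0 // tE; apply/maxn_idPr.
have -> : cube_min a (upd (origin r I) i t) = upd (origin r I) i (a i).
  apply: cubeP => j; rewrite cube_minE !updE ffunE.
  by case: eqP => [->|_] /=; rewrite ?minn0 // tE; apply/minn_idPl.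
rewrite !axis. lia.
Qed.

(** A jump is maximal among the points of at least the same rank. *)
Lemma jump_max a b : jump rho a -> cube_le a b -> rho a <= rho b -> a = b.
Proof.
move=> [_ drop] ab rab; apply: contrapT => /(cube_le_neq ab)[i lt_i].
have ti : ((a i).+1 < r.+1)%N by have := ltn_ord (b i); lia.
have := drop i (Ordinal ti) erefl.
have : rho b <= rho (upd a i (Ordinal ti)) by apply/rank_le/upd_le.
lia.
Qed.

Lemma rank_jump_lt a b : jump rho a -> cube_le a b -> a <> b -> rho b < rho a.
Proof. by move=> ja ab neq; rewrite ltNge; apply/negP => /(jump_max ja ab). Qed.

(** Above any point [c] there is at most one jump of at least the same rank. *)
Lemma jump_uniq c a b : jump rho a -> jump rho b ->
  cube_le c a -> cube_le c b -> rho c <= rho a -> rho c <= rho b -> a = b.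
Proof.
move=> ja jb ca cb rca rcb.
have := rank_max_min a b.
have : rho (cube_min a b) <= rho c.
  by apply: rank_le => i; rewrite cube_minE leq_min ca cb.
move=> le_c le_ab.
have a_le : cube_le a (cube_max a b) by move=> i; rewrite cube_maxE leq_maxl.
have b_le : cube_le b (cube_max a b) by move=> i; rewrite cube_maxE leq_maxr.
by rewrite (jump_max ja a_le) 1?{2}(jump_max jb b_le) //; lia.
Qed.

(** Such a [b] is found as a point [b <= a] of rank greater than that of [a]
    and of maximal coordinate sum. *)
Lemma jump_pred a (i0 : I) : jump rho a -> rho a < r%:Z ->
  exists b i, [/\ jump rho b, rho b = rho a + 1, cube_le b a & (b i < a i)%N].
Proof.
move=> [ra0 drop_a] lt_r; have [axis _ _ _] := rhoP.
pose P b := [forall i, (b i <= a i)%N] && (rho a < rho b).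
have P0 : P (origin r I).
  apply/andP; split; first by apply/forallP => i; rewrite ffunE.
  have <- : upd (origin r I) i0 ord0 = origin r I.
    by apply: cubeP => j; rewrite updE ffunE; case: eqP.
  by rewrite axis subr0.
pose total b := (\sum_i b i)%N.
case: (arg_maxnP total P0) => b /andP[/forallP le_ba lt_ab] b_max.
have ltP i t : t = (b i).+1 :> nat -> (b i < a i)%N -> rho (upd b i t) <= rho a.
  move=> tE lt_i; rewrite leNgt; apply/negP => lt_upd.
  have /b_max : P (upd b i t).
    rewrite /P lt_upd andbT; apply/forallP; apply: upd_le => //.
    by rewrite tE.
  suff -> : total (upd b i t) = (total b).+1 by rewrite /= ltnn.
  rewrite /total (bigD1 i) // [in RHS](bigD1 i) //= updE eqxx tE addSn.
  by congr (_ + _).+1; apply: eq_bigr => j /negPf ji; rewrite updE ji.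
have [i lt_i] : exists i, (b i < a i)%N.
  by apply: cube_le_neq => // ba; rewrite ba ltxx in lt_ab.
have si : ((b i).+1 < r.+1)%N by have := ltn_ord (a i); lia.
have := ltP i (Ordinal si) erefl lt_i.
have := @rank_upd_ge b i (Ordinal si) erefl => ge_upd le_upd.
have rbE : rho b = rho a + 1 by lia.
exists b, i; split => //; split; first by lia.
move=> k t tE; apply/eqP; rewrite eq_le rank_upd_ge // andbT.
have [lt_k|] := ltnP (b k) (a k); first by have := ltP k t tE lt_k; lia.
move=> ge_k; have bk : b k = a k :> nat by apply/eqP; rewrite eqn_leq le_ba.
(* here [b + e_k] is not below [a]; compare with the drop of [a] along [k] *)
have := rank_max_min (upd b k t) a.
have -> : cube_max (upd b k t) a = upd a k t.
  apply: cubeP => j; rewrite cube_maxE !updE; case: eqP => [->|_].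
    by apply/maxn_idPl; rewrite tE bk.
  exact/maxn_idPr.
have -> : cube_min (upd b k t) a = b.
  apply: cubeP => j; rewrite cube_minE !updE; case: eqP => [->|_].
    by rewrite bk; apply/minn_idPr; rewrite tE bk.
  exact/minn_idPl.
by rewrite (drop_a k t) 1?tE 1?bk //; lia.
Qed.

End RankFunctionTheory.

Lemma standard_rankP (r : nat) (I : finType) :
  rank_function (@standard_rank r I).
Proof.
split.
- move=> i t; rewrite /standard_rank (bigD1 i) //= updE eqxx big1 ?addr0.
    by rewrite /Num.max; case: ifP => //; have := ltn_ord t; lia.
  by move=> j /negPf ji; rewrite updE ji ffunE.
- move=> a b ab; rewrite /standard_rank.
  have : \sum_(i : I) (a i)%:Z <= \sum_(i : I) (b i)%:Z.
    by apply: ler_sum => i _; rewrite lez_nat.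
  by lia.
- move=> a b; rewrite /standard_rank.
  have : \sum_(i : I) (cube_min a b i)%:Z <= \sum_(i : I) (a i)%:Z.
    by apply: ler_sum => i _; rewrite lez_nat cube_minE geq_minl.
  have : \sum_(i : I) (cube_min a b i)%:Z <= \sum_(i : I) (b i)%:Z.
    by apply: ler_sum => i _; rewrite lez_nat cube_minE geq_minr.
  have : \sum_(i : I) (cube_max a b i)%:Z + \sum_(i : I) (cube_min a b i)%:Z
      = \sum_(i : I) (a i)%:Z + \sum_(i : I) (b i)%:Z.
    rewrite -!big_split; apply: eq_bigr => i _ /=.
    by rewrite cube_maxE cube_minE -!PoszD addnC addn_min_max.
  by lia.
- move=> a; rewrite /standard_rank.
  have : 0 <= \sum_(i : I) (a i)%:Z by apply: sumr_ge0.
  by lia.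
Qed.

(** * Piecewise affine functions on a segment *)

Section PiecewiseAffine.
Variable R : realType.
Implicit Types (phi : R -> R) (a b c s : R) (m : int).

(** [phi] is affine with slope [m] on [[b, c]]. *)
Definition affine_on phi b c m :=
  forall s, b <= s <= c -> phi s = phi b + m%:~R * (s - b).

(** [pw_affine phi a b]: [phi] is piecewise affine with integral slopes on
    [[a, b]].  The inductive form appends one affine piece at a time. *)
Inductive pw_affine phi a : R -> Prop :=
| pw_affine_nil : pw_affine phi a a
| pw_affine_cons b c m : pw_affine phi a b -> b < c -> affine_on phi b c m ->
    pw_affine phi a c.

Lemma pw_affine_subdivision phi a b : pw_affine phi a b ->
  exists (n : nat) (t : nat -> R) (m : nat -> int),
    [/\ t 0%N = a, t n = b, forall i, (i < n)%N -> t i < t i.+1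
      & forall i, (i < n)%N -> affine_on phi (t i) (t i.+1) (m i)].
Proof.
elim=> [|b' c m' _ [n [t [m [t0 tn t_lt t_aff]]]] bc aff].
  by exists 0%N, (fun=> a), (fun=> 0).
exists n.+1, (fun i => if (i <= n)%N then t i else c),
  (fun i => if (i < n)%N then m i else m').
split=> [||i|i].
- by [].
- by rewrite ltnn.
- rewrite ltnS => le_in; rewrite le_in.
  by case: ltngtP le_in => [/t_lt| |->]; rewrite ?tn.
rewrite ltnS => le_in; rewrite le_in; case: ltngtP le_in => [/t_aff| |->] //.
by rewrite tn.
Qed.

(** The positive part of [s - tau]. *)
Definition ramp (tau s : R) : R := Num.max 0 (s - tau).

Lemma ramp_le tau s : s <= tau -> ramp tau s = 0.
Proof. by move=> st; apply/max_idPl; rewrite subr_le0. Qed.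

Lemma ramp_ge tau s : tau <= s -> ramp tau s = s - tau.
Proof. by move=> st; apply/max_idPr; rewrite subr_ge0. Qed.

Lemma ramp_convex tau a b c : a <= b <= c ->
  ramp tau b * (c - a) <= ramp tau a * (c - b) + ramp tau c * (b - a).
Proof.
move=> /andP[ab bc]; have [hb|/ltW hb] := leP b tau.
  rewrite (ramp_le hb) mul0r.
  by rewrite addr_ge0 // mulr_ge0 ?subr_ge0 // le_max lexx.
rewrite (ramp_ge hb).
have -> : (b - tau) * (c - a) = (a - tau) * (c - b) + (c - tau) * (b - a).
  by ring.
by apply: lerD; rewrite ler_wpM2r ?subr_ge0 // le_max lexx orbT.
Qed.

Lemma ramp_lipschitz tau tau' s : `|ramp tau s - ramp tau' s| <= `|tau - tau'|.
Proof.
have d1 := ler_norm (tau - tau'); have := ler_norm (tau' - tau).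
rewrite distrC ler_norml => d2.
have [h|/ltW h] := leP s tau; have [h'|/ltW h'] := leP s tau';
  rewrite ?(ramp_le h, ramp_ge h) ?(ramp_le h', ramp_ge h'); lra.
Qed.

Lemma affine_add_ramp phi b c m (d : int) tau : b < c -> affine_on phi b c m ->
  (tau <= b) || (c <= tau) ->
  exists m', affine_on (fun s => phi s - d%:~R * ramp tau s) b c m'.
Proof.
move=> bc aff /orP[tb|ct].
  exists (m - d) => s /[dup] /aff -> /andP[bs sc].
  by rewrite !ramp_ge ?(le_trans tb) // rmorphB /=; ring.
exists m => s /[dup] /aff -> /andP[bs sc].
by rewrite !ramp_le ?(le_trans _ ct) // ?(ltW bc) //; ring.
Qed.

Lemma pw_affine_add_ramp phi a b (d : int) tau : pw_affine phi a b ->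
  pw_affine (fun s => phi s - d%:~R * ramp tau s) a b.
Proof.
elim=> [|b' c m _ IH bc aff]; first exact: pw_affine_nil.
have [tb|bt] := leP tau b'.
  have [|m' aff'] := affine_add_ramp d bc aff (tau := tau); first by rewrite tb.
  exact: pw_affine_cons aff'.
have [ct|tc] := leP c tau.
  have [|m' aff'] := affine_add_ramp d bc aff (tau := tau).
    by rewrite ct orbT.
  exact: pw_affine_cons aff'.
have [||m1 aff1] := @affine_add_ramp phi b' tau m d tau bt.
- by move=> s /andP[bs st]; apply: aff; rewrite bs (le_trans st (ltW tc)).
- by rewrite lexx orbT.
have [||m2 aff2] := @affine_add_ramp phi tau c m d tau tc.
- move=> s /andP[ts sc]; rewrite (aff s) ?sc ?(le_trans (ltW bt)) //.
  by rewrite (aff tau) ?ltW //; ring.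
- by rewrite lexx.
exact: pw_affine_cons (pw_affine_cons IH bt aff1) tc aff2.
Qed.

Section Ramps.
Variables (r : nat) (sl : nat -> int).

(** The affine function of slope [sl r] with value [c] at [0], minus ramps which
    lower the slope by [sl j.+1 - sl j] at [tau j], for each [j < r].  The
    [tau j] need not be sorted. *)
Definition ramp_sum (c : R) (tau : nat -> R) (s : R) : R :=
  c + (sl r)%:~R * s
  - \sum_(j < r) (sl j.+1 - sl j)%:~R * ramp (tau j) s.

Lemma pw_affine_ramp_sum c tau a b : a <= b -> pw_affine (ramp_sum c tau) a b.
Proof.
move=> ab; rewrite /ramp_sum.
elim: (index_enum _) => [|j l IH].
  have [->|neq] := eqVneq a b; first exact: pw_affine_nil.
  apply: (pw_affine_cons (b := a) (m := sl r)); first exact: pw_affine_nil.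
    by rewrite lt_neqAle neq.
  by move=> s _; rewrite !big_nil; ring.
have := pw_affine_add_ramp (sl j.+1 - sl j) (tau j) IH.
by congr pw_affine; apply/funext => s; rewrite big_cons; ring.
Qed.

Lemma ramp_sum_lipschitz c c' tau tau' s eps :
  `|c - c'| <= eps -> (forall j, (j < r)%N -> `|tau j - tau' j| <= eps) ->
  `|ramp_sum c tau s - ramp_sum c' tau' s|
    <= (1 + \sum_(j < r) `|(sl j.+1 - sl j)%:~R|) * eps.
Proof.
move=> cc tt; rewrite /ramp_sum.
have -> : forall A B B' : R, c + A - B - (c' + A - B') = (c - c') + (B' - B).
  by move=> *; ring.
rewrite mulrDl mul1r; apply: le_trans (ler_normD _ _) _; apply: lerD => //.
rewrite -sumrB mulr_suml; apply: le_trans (ler_norm_sum _ _ _) _.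
apply: ler_sum => j _; rewrite -mulrBr normrM ler_wpM2l //.
by rewrite distrC; apply: le_trans (ramp_lipschitz _ _ _) (tt _ _).
Qed.

Lemma ramp_sum_concave c tau x y z :
  (forall j, (j < r)%N -> sl j < sl j.+1) -> x <= y <= z ->
  ramp_sum c tau x * (z - y) + ramp_sum c tau z * (y - x)
    <= ramp_sum c tau y * (z - x).
Proof.
move=> sl_lt xyz; rewrite /ramp_sum -subr_ge0.
set B := \sum_(j < r) _; set B' := \sum_(j < r) _; set B'' := \sum_(j < r) _.
have -> : forall A, (c + A * y - B) * (z - x) -
    ((c + A * x - B') * (z - y) + (c + A * z - B'') * (y - x)) =
    B' * (z - y) + B'' * (y - x) - B * (z - x) by move=> A; ring.
rewrite !mulr_suml -big_split -sumrB /=; apply: sumr_ge0 => j _.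
rewrite -!mulrA -mulrDr -mulrBr mulr_ge0 ?subr_ge0 ?ramp_convex //.
by rewrite ler0z subr_ge0 ltW ?sl_lt.
Qed.

(** A piecewise affine function whose slopes [sl (k i)] have nonincreasing
    indices is a sum of ramps: [tau j] is the place where the index goes from
    above [j] to at most [j].  In the induction, the ramps [j] that have not yet
    been passed have [tau j] at the current end of the interval. *)
Lemma concave_ramp_sum phi n (t : nat -> R) (k : nat -> nat) :
  t 0%N = 0 -> (forall i, (i < n)%N -> t i < t i.+1) ->
  (forall i, (i < n)%N -> affine_on phi (t i) (t i.+1) (sl (k i))) ->
  (forall i, (i < n)%N -> (k i <= r)%N) ->
  (forall i, (i.+1 < n)%N -> (k i.+1 <= k i)%N) ->
  exists tau, (forall j, 0 <= tau j <= t n) /\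
    forall s, 0 <= s <= t n -> phi s = ramp_sum (phi 0) tau s.
Proof.
move=> t0 t_lt t_aff k_le k_anti.
suff : exists tau, [/\ forall j, 0 <= tau j <= t n,
    forall j, (j < if n is n'.+1 then k n' else r)%N -> tau j = t n
    & forall s, 0 <= s <= t n -> phi s = ramp_sum (phi 0) tau s].
  by case=> tau [? _ ?]; exists tau.
elim: n t_lt t_aff k_le k_anti => [|n IH] t_lt t_aff k_le k_anti.
  exists (fun=> 0); rewrite t0; split=> // [j|s s0]; first by rewrite lexx.
  have -> : s = 0 by apply/le_anti; rewrite andbC.
  by rewrite /ramp_sum big1 => [|j _]; rewrite ?ramp_le //; ring.
case: IH => [i lt_i|i lt_i|i lt_i|i lt_i|tau [tau_bd tau_top tauP]].
- by apply: t_lt; rewrite ltnW.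
- by apply: t_aff; rewrite ltnW.
- by apply: k_le; rewrite ltnW.
- by apply: k_anti; rewrite ltnW.
have lt_n := t_lt n (ltnSn n).
have tn0 : 0 <= t n by have /andP[/le_trans] := tau_bd 0%N; apply.
have kn_le : (k n <= if n is n'.+1 then k n' else r)%N.
  by case: (n) k_le k_anti => [|n'] k_le k_anti; [apply: k_le | apply: k_anti].
pose tau' j := if (j < k n)%N then t n.+1 else tau j.
exists tau'; split=> [j|j lt_j|].
- rewrite /tau'; case: ifP => _; first by rewrite lexx andbT; lra.
  by have /andP[-> /le_trans ->] := tau_bd j; rewrite ?ltW.
- by rewrite /tau' lt_j.
have low s : 0 <= s <= t n -> phi s = ramp_sum (phi 0) tau' s.
  move=> /[dup] /tauP -> /andP[s0 sn]; congr (_ - _); apply: eq_bigr => j _.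
  congr (_ * _); rewrite /tau'; case: ifP => // lt_j.
  rewrite tau_top ?(leq_trans lt_j) // !ramp_le //.
  by rewrite (le_trans sn) ?ltW.
move=> s /andP[s0 sn]; have [/(conj s0)/andP/low //|/ltW ns] := leP s (t n).
rewrite (t_aff n (ltnSn n) s) ?ns // low ?lexx ?tn0 // /ramp_sum.
suff -> : \sum_(j < r) (sl j.+1 - sl j)%:~R * ramp (tau' j) s =
    \sum_(j < r) (sl j.+1 - sl j)%:~R * ramp (tau' j) (t n)
    + (sl r - sl (k n))%:~R * (s - t n) by rewrite rmorphB /=; ring.
have -> : sl r - sl (k n) =
    \sum_(j < r) (if (j < k n)%N then 0 else sl j.+1 - sl j).
  rewrite -(big_mkord xpredT
    (fun j => if (j < k n)%N then 0 else sl j.+1 - sl j)).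
  have kr : (k n <= r)%N by apply: k_le.
  rewrite (big_cat_nat (leq0n _) kr) /= big_nat.
  rewrite big1 ?add0r => [|j /andP[_ ->]] //.
  rewrite -(telescope_sumr sl kr); apply: eq_big_nat => j /andP[].
  by rewrite leqNgt => /negPf ->.
rewrite rmorph_sum mulr_suml -big_split /=; apply: eq_bigr => j _.
rewrite /tau'; case: ifP => _.
  by rewrite !ramp_le // ?ltW //; ring.
have /andP[_ tj] := tau_bd j.
by rewrite !ramp_ge ?(le_trans tj) //; ring.
Qed.

End Ramps.
End PiecewiseAffine.

(** * Points and slopes on a metric graph *)

Section Points.
Variables (R : realType) (G : metric_graph R).
Implicit Types (e : edge G) (h : oedge G) (x : gpoint G) (s : R).

Lemma on_edge_src e s : s <= 0 -> on_edge e s = inl (src e).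
Proof. by rewrite /on_edge => ->. Qed.

Lemma on_edge_tgt e s : len e <= s -> on_edge e s = inl (tgt e).
Proof.
move=> es; rewrite /on_edge leNgt (lt_le_trans (len_gt0 e) es) /=.
by rewrite insubF //= [s < _]ltNge es andbF.
Qed.

Lemma on_edge_inner e s : 0 < s < len e ->
  exists2 p, on_edge e s = inr p & sval p = (e, s).
Proof.
move=> /[dup] es /andP[s0 _]; rewrite /on_edge leNgt s0 /=.
rewrite (@insubT _ (fun p : edge G * R => 0 < p.2 < len p.1) _ (e, s) es) /=.
by eexists.
Qed.

(** The point at distance [s] from the tail of [h] along the oriented edge [h],
    for [0 <= s <= len h.1]. *)
Definition hpoint h s : gpoint G :=
  on_edge h.1 (if h.2 then len h.1 - s else s).

(** The position of [x] along [h], when [h] is a tangent vector at [x]: the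
    number [s] with [hpoint h s = x] ([hpoint_pos]).  A vertex is the tail of
    its tangent vectors, hence the value [0]. *)
Definition pos x h : R :=
  if x is inr p then if h.2 then len h.1 - (val p).2 else (val p).2 else 0.

Lemma move_hpoint x (nu : tangent x) s :
  move nu s = hpoint (val nu) (pos x (val nu) + s).
Proof.
case: x nu => [v|p] [[e b]]; rewrite /move /hpoint /pos /= inE /= => /eqP E.
  by case: b {E} => /=; rewrite add0r.
by rewrite E; case: b {E}; congr on_edge; ring.
Qed.

Lemma pos_bounds x (nu : tangent x) : 0 <= pos x (val nu) < len (val nu).1.
Proof.
case: x nu => [v|p] [[e b]]; rewrite /pos /= inE /= => /eqP E.
  by rewrite lexx len_gt0.
by have := valP p; rewrite -E; case: b {E} => /= /andP[]; lra.
Qed.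

Lemma hpoint_pos x (nu : tangent x) : hpoint (val nu) (pos x (val nu)) = x.
Proof.
case: x nu => [v|p] [[e b]]; rewrite /hpoint /pos /= inE /= => /eqP E.
  by case: b E => <-; [rewrite subr0 on_edge_tgt | rewrite on_edge_src].
have -> : (if b then len e - (if b then len e - (val p).2 else (val p).2)
   else (if b then len e - (val p).2 else (val p).2)) = (val p).2.
  by case: b {E} => //; ring.
have [|q -> qE] := @on_edge_inner e (val p).2.
  by rewrite E; apply: (valP p).
congr inr; apply: val_inj; rewrite /= qE E.
exact/esym/surjective_pairing.
Qed.

Lemma hpoint_tangent h s : 0 <= s < len h.1 -> h \in tangent_set (hpoint h s).
Proof.
case: h => e b /= /andP[s0 se]; rewrite /hpoint /=.
have [->|neq] := eqVneq s 0.
  by case: b; [rewrite subr0 on_edge_tgt | rewrite on_edge_src]; rewrite ?inE.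
have {}s0 : 0 < s by rewrite lt_neqAle eq_sym neq.
have [|p -> pE] := @on_edge_inner e (if b then len e - s else s).
  by case: b; lra.
by rewrite inE /= pE.
Qed.

Lemma pos_hpoint h s : 0 <= s < len h.1 -> pos (hpoint h s) h = s.
Proof.
case: h => e b /= /andP[s0 se]; rewrite /hpoint /pos /=.
have [->|neq] := eqVneq s 0.
  by case: b; [rewrite subr0 on_edge_tgt | rewrite on_edge_src].
have {}s0 : 0 < s by rewrite lt_neqAle eq_sym neq.
have [|p -> /= ->] := @on_edge_inner e (if b then len e - s else s).
  by case: b; lra.
by case: b => //=; ring.
Qed.

Lemma hpoint_opposite h s : hpoint (opposite h) s = hpoint h (len h.1 - s).
Proof. by case: h => e [] /=; rewrite /hpoint //=; congr on_edge; ring. Qed.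

Lemma hpoint_inner h s : 0 < s < len h.1 ->
  exists2 p, hpoint h s = inr p & (sval p).1 = h.1.
Proof.
move=> hs.
have [|p pE vE] := @on_edge_inner h.1 (if h.2 then len h.1 - s else s).
  by case: ifP => _; lra.
by exists p; rewrite ?vE.
Qed.

Lemma hpoint_opposite_tangent h s : 0 < s < len h.1 ->
  opposite h \in tangent_set (hpoint h s).
Proof. by move=> /hpoint_inner[p -> pE]; rewrite inE /= pE. Qed.

Lemma pos_opposite h s : 0 < s < len h.1 ->
  pos (hpoint h s) (opposite h) = len h.1 - s.
Proof.
move=> hs; have -> : hpoint h s = hpoint (opposite h) (len h.1 - s).
  by rewrite hpoint_opposite; congr hpoint; ring.
by rewrite pos_hpoint //=; lra.
Qed.

Lemma hpoint_inj h s s' : 0 <= s < len h.1 -> 0 <= s' < len h.1 ->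
  hpoint h s = hpoint h s' -> s = s'.
Proof. by move=> hs hs' eq_h; rewrite -(pos_hpoint hs) eq_h pos_hpoint. Qed.

End Points.

Section Subdivisions.
Variables (R : realType) (n : nat) (t : nat -> R).

Lemma subdivision_right s : t 0%N <= s < t n ->
  exists2 i, (i < n)%N & t i <= s < t i.+1.
Proof.
elim: n => [|k IH] /andP[s0 sn].
  by have := le_lt_trans s0 sn; rewrite ltxx.
have [ks|sk] := leP (t k) s; first by exists k; rewrite ?ks.
by case: IH => [|i lt_i ts]; [rewrite s0 sk | exists i => //; rewrite ltnW].
Qed.

Lemma subdivision_left s : t 0%N < s <= t n ->
  exists2 i, (i < n)%N & t i < s <= t i.+1.
Proof.
elim: n => [|k IH] /andP[s0 sn].
  by have := lt_le_trans s0 sn; rewrite ltxx.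
have [sk|ks] := leP s (t k); last by exists k; rewrite ?ks.
by case: IH => [|i lt_i ts]; [rewrite s0 sk | exists i => //; rewrite ltnW].
Qed.

Lemma subdivision_le i j : (forall i, (i < n)%N -> t i < t i.+1) ->
  (i <= j <= n)%N -> t i <= t j.
Proof.
move=> t_lt; elim: j => [|j IH] /andP[ij jn].
  by move: ij; rewrite leqn0 => /eqP->.
move: ij; rewrite leq_eqVlt => /predU1P[->//|ij].
by apply: le_trans (ltW (t_lt j jn)); apply: IH; rewrite -ltnS ij ltnW.
Qed.
End Subdivisions.

Section Slopes.
Variables (R : realType) (G : metric_graph R).
Implicit Types (e : edge G) (h : oedge G) (x : gpoint G) (s : R).
Implicit Types (f : gpoint G -> R).

(** The slope is determined by the values near [x]. *)
Lemma slope_eq f x (nu : tangent x) (m : int) eps : 0 < eps ->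
  (forall s, 0 <= s <= eps -> f (move nu s) = f x + m%:~R * s) ->
  slope f nu = m.
Proof.
move=> eps0 fm; rewrite /slope; case: xgetP => [m' _ [eps' eps'0 fm']|].
  pose d := Num.min eps eps'.
  have d0 : 0 < d by rewrite lt_min eps0.
  have dl : d <= eps by rewrite ge_min lexx.
  have dl' : d <= eps' by rewrite ge_min lexx orbT.
  have := fm d; rewrite fm' ?dl ?dl' ?(ltW d0) // => /(_ isT)/addrI.
  by move/(mulIf (lt0r_neq0 d0))/intr_inj.
by move=> /(_ m) []; exists eps.
Qed.

Lemma RatG_right_slope f h s : RatG f -> 0 <= s < len h.1 ->
  exists (m : int) (eps : R), [/\ 0 < eps, s + eps <= len h.1
    & forall u, 0 <= u <= eps ->
        f (hpoint h (s + u)) = f (hpoint h s) + m%:~R * u].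
Proof.
case: h => e b /= fR /andP[s0 sl].
have [n [t [m [t0 tn t_lt t_aff]]]] := fR e.
case: b; rewrite /hpoint /=.
  have [|i lt_i /andP[ts st]] := @subdivision_left _ n t (len e - s).
    by rewrite t0 tn; lra.
  exists (- m i), (len e - s - t i); split; [lra| |].
    have := subdivision_le t_lt (i := 0) (j := i).
    by rewrite t0 /= ltnW // => /(_ isT); lra.
  move=> u /andP[u0 ut]; rewrite (t_aff i lt_i (len e - s)) ?(ltW ts) //.
  by rewrite (t_aff i lt_i (len e - (s + u))) ?rmorphN /=; [ring | lra].
have [|i lt_i /andP[ts st]] := @subdivision_right _ n t s.
  by rewrite t0 tn; lra.
exists (m i), (t i.+1 - s); split; [lra| |].
  have := subdivision_le t_lt (i := i.+1) (j := n); rewrite tn lt_i leqnn.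
  by move=> /(_ isT); lra.
move=> u /andP[u0 ut]; rewrite (t_aff i lt_i s) ?ts ?ltW //.
by rewrite (t_aff i lt_i (s + u)); [ring | lra].
Qed.

Lemma slopeP f x (nu : tangent x) : RatG f ->
  exists eps : R, [/\ 0 < eps, pos x (val nu) + eps <= len (val nu).1
    & forall u, 0 <= u <= eps ->
      f (hpoint (val nu) (pos x (val nu) + u)) = f x + (slope f nu)%:~R * u].
Proof.
move=> fR.
have [m [eps [eps0 le_len fm]]] := RatG_right_slope fR (pos_bounds nu).
exists eps; split => // u ue; rewrite fm // hpoint_pos; congr (_ + _%:~R * _).
apply/esym/(slope_eq eps0) => w we.
by rewrite move_hpoint fm // hpoint_pos.
Qed.

End Slopes.

(** * Compatible functions *)

Section CompatibleFunctions.
Variables (R : realType) (G : metric_graph R) (r : nat).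
Variable S : slope_structure G r.
Implicit Types (e : edge G) (h : oedge G) (x : gpoint G).
Implicit Types (f g : gpoint G -> R) (s : R).

Lemma ss_slope_le h (i j : 'I_r.+1) :
  (ss_slope S h i <= ss_slope S h j) = (i <= j)%N.
Proof.
case: (ltngtP i j) => [/(ss_slope_incr S h)/ltW //| |/val_inj ->].
  move/(ss_slope_incr S h).
  by rewrite ltNge => /negPf.
exact: lexx.
Qed.

Lemma slope_vector_inj x : injective (@slope_vector _ _ _ S x).
Proof.
move=> a b eq_ab; apply: cubeP => nu.
move/ffunP/(_ nu): eq_ab; rewrite !ffunE => E.
by apply/eqP; rewrite eqn_leq -!(ss_slope_le (val nu)) E lexx.
Qed.

Lemma slope_rank_vector x (a : cube r (tangent x)) :
  slope_rank S (slope_vector S a) = rank_at S a.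
Proof.
rewrite /slope_rank; congr rank_at.
by case: xgetP => [b _ /slope_vector_inj //|/(_ a)[]].
Qed.

Lemma rank_atP x : rank_function (@rank_at _ _ _ S x).
Proof. by case: x => [v|p]; [apply: ss_rankP | apply: standard_rankP]. Qed.

Lemma compatibleP f x : compatible S f ->
  exists2 a, jump (@rank_at _ _ _ S x) a & slopes f x = slope_vector S a.
Proof. by case=> _ /(_ x)[_ [a ja <-]]; exists a. Qed.

Lemma slope_index f x (a : cube r (tangent x)) (nu : tangent x) :
  slopes f x = slope_vector S a -> slope f nu = ss_slope S (val nu) (a nu).
Proof. by move/ffunP/(_ nu); rewrite !ffunE. Qed.

Lemma standard_rank_two (I : finType) (a : cube r I) (i j : I) (k : int) :
  i != j -> 0 <= k <= standard_rank a -> (a i)%:Z + (a j)%:Z + k <= r%:Z.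
Proof.
move=> ij; rewrite /standard_rank (bigD1 i) //= (bigD1 j) 1?eq_sym //=.
set s := \sum_(_ | _) _; have : 0 <= s by apply: sumr_ge0.
lia.
Qed.

Lemma rank_at_inner x p (a : cube r (tangent x)) : x = inr p ->
  rank_at S a = standard_rank a.
Proof. by move=> xE; move: a; rewrite xE. Qed.

(** Inside an edge, the index of the slope of a compatible function drops by at
    least the rank: the index is [i] past the point and [j] before it. *)
Lemma index_drop f h s (k : int) : compatible S f -> 0 < s < len h.1 ->
  0 <= k <= slope_rank S (slopes f (hpoint h s)) ->
  exists (nu nu' : tangent (hpoint h s)) (i j : 'I_r.+1),
    [/\ val nu = h, val nu' = opposite h,
        slope f nu = ss_slope S h i, slope f nu' = - ss_slope S h j
      & i%:Z + k <= j%:Z].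
Proof.
move=> fS hs; have [a _ aE] := compatibleP (hpoint h s) fS.
rewrite aE slope_rank_vector => k_le.
have h_tan : h \in tangent_set (hpoint h s) by apply: hpoint_tangent; lra.
have opp_tan := hpoint_opposite_tangent hs.
pose nu : tangent (hpoint h s) := Sub h h_tan.
pose nu' : tangent (hpoint h s) := Sub (opposite h) opp_tan.
exists nu, nu', (a nu), (rev_ord (a nu')); split => //.
- exact: (slope_index nu aE).
- rewrite (slope_index nu' aE); apply/eqP; rewrite -addr_eq0 addrC.
  by have := ss_slope_opposite S h (rev_ord (a nu')); rewrite rev_ordK => ->.
have neq : nu != nu'.
  rewrite -val_eqE /= /opposite; case: (h) => e b.
  by rewrite xpair_eqE; case: b; rewrite andbF.
have [p pE _] := hpoint_inner hs.
rewrite (rank_at_inner _ pE) in k_le.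
have := standard_rank_two neq k_le; have := ltn_ord (a nu'); rewrite /=; lia.
Qed.

(** The slopes [s_j] of the edge [e] oriented from [src e] to [tgt e], indexed
    by natural numbers; only the values at [j <= r] matter. *)
Definition edge_slope e (j : nat) : int := ss_slope S (e, false) (inord j).

Lemma edge_slope_lt e j : (j < r)%N -> edge_slope e j < edge_slope e j.+1.
Proof. by move=> jr; apply: ss_slope_incr; rewrite !inordK // ltnS ltnW. Qed.

Lemma compatible_edge_form f e : compatible S f ->
  exists tau : nat -> R, (forall j, 0 <= tau j <= len e) /\
    forall s, 0 <= s <= len e ->
      f (on_edge e s) = ramp_sum r (edge_slope e) (f (inl (src e))) tau s.
Proof.
move=> fS; have [fR fSx] := fS.
have [n [t [m [t0 tn t_lt t_aff]]]] := fR e.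
have t_bd i : (i < n)%N -> 0 <= t i < len e.
  move=> lt_i; have := subdivision_le t_lt (i := 0) (j := i).
  rewrite t0 /= ltnW //.
  have := subdivision_le t_lt (i := i.+1) (j := n); rewrite tn lt_i leqnn.
  by move=> /(_ isT) + /(_ isT); have := t_lt i lt_i; lra.
have slope_m i (nu : tangent (hpoint (e, false) (t i))) : (i < n)%N ->
    val nu = (e, false) -> slope f nu = m i.
  move=> lt_i nuE; have lt_t := t_lt i lt_i.
  apply: (slope_eq (eps := t i.+1 - t i)); first by lra.
  move=> u /andP[u0 ut]; rewrite move_hpoint nuE pos_hpoint ?t_bd //.
  rewrite [LHS](t_aff i lt_i); last by lra.
  by congr (_ + _); ring.
have [k kE] : exists k : nat -> 'I_r.+1, forall i, (i < n)%N ->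
    m i = ss_slope S (e, false) (k i).
  suff /choice[k kE] : forall i, exists j : 'I_r.+1,
    (i < n)%N -> m i = ss_slope S (e, false) j by exists k.
  move=> i.
  have [lt_i|] := ltnP i n; last by exists ord0.
  have in_tan := @hpoint_tangent _ _ (e, false) (t i) (t_bd i lt_i).
  have [/(_ (Sub (e, false) in_tan))[j jE] _] := fSx (hpoint (e, false) (t i)).
  by exists j => _; rewrite -jE slope_m.
have k_anti i : (i.+1 < n)%N -> (k i.+1 <= k i)%N.
  move=> lt_i.
  rewrite -(ss_slope_le (e, false)) -(kE _ lt_i) -(kE _ (ltnW lt_i)).
  have lt_t := t_lt i (ltnW lt_i).
  have ti0 := t_bd i (ltnW lt_i); have ti1 := t_bd i.+1 lt_i.
  have ti1' : 0 < t i.+1 < len (e, false).1 by rewrite /=; lra.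
  have [|nu [nu' [j [j' [nuE nuE' jE jE' le_jj]]]]] :=
    @index_drop f (e, false) (t i.+1) 0 fS ti1'.
    rewrite lexx /=.
    have [a [] + _ ->] := compatibleP (hpoint (e, false) (t i.+1)) fS.
    by rewrite slope_rank_vector.
  rewrite -(slope_m i.+1 nu) // jE.
  suff -> : m i = ss_slope S (e, false) j' by rewrite ss_slope_le; lia.
  apply: oppr_inj; rewrite -jE'; apply/esym/(slope_eq (eps := t i.+1 - t i)).
    by lra.
  move=> u /andP[u0 ut].
  rewrite move_hpoint nuE' pos_opposite // hpoint_opposite /=.
  rewrite [LHS](t_aff i (ltnW lt_i)) /=; last by lra.
  rewrite [f (hpoint _ _)](t_aff i (ltnW lt_i) (t i.+1)); last first.
    by rewrite ltW ?lexx.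
  by rewrite rmorphN /=; ring.
have [|||tau [tau_bd tauP]] := @concave_ramp_sum R r (edge_slope e)
  (fun s => f (on_edge e s)) n t k t0 t_lt.
- by move=> i lt_i; rewrite /edge_slope inord_val -kE //; apply: t_aff.
- by move=> i _; rewrite -ltnS.
- by [].
exists tau; rewrite -tn; split => // s /tauP ->.
by rewrite on_edge_src.
Qed.

Lemma compatible_concave f h (x y z : R) : compatible S f ->
  0 <= x -> x <= y -> y <= z -> z <= len h.1 ->
  f (hpoint h x) * (z - y) + f (hpoint h z) * (y - x)
    <= f (hpoint h y) * (z - x).
Proof.
move=> fS x0 xy yz zl; case: h zl => e b /= zl.
have [tau [_ tauP]] := compatible_edge_form e fS.
rewrite /hpoint /=; case: b; rewrite !tauP; try by lra.
  have := @ramp_sum_concave R r (edge_slope e) (f (inl (src e))) tau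
    (len e - z) (len e - y) (len e - x) (@edge_slope_lt e).
  have -> : len e - z <= len e - y <= len e - x by lra.
  have -> : len e - x - (len e - y) = y - x by ring.
  have -> : len e - x - (len e - z) = z - x by ring.
  have -> : len e - y - (len e - z) = z - y by ring.
  by rewrite addrC; apply.
by apply: ramp_sum_concave; [apply: edge_slope_lt | lra].
Qed.

(** By concavity, a compatible function lies below its tangents. *)
Lemma compatible_le_tangent f x (nu : tangent x) s : compatible S f ->
  0 <= s -> pos x (val nu) + s <= len (val nu).1 ->
  f (hpoint (val nu) (pos x (val nu) + s)) <= f x + (slope f nu)%:~R * s.
Proof.
move=> fS s0 sl; have [fR _] := fS.
have [eps [eps0 _ epsP]] := slopeP nu fR.
have [s_le|/ltW s_ge] := leP s eps; first by rewrite epsP ?s0.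
have /andP[p0 _] := pos_bounds nu.
have := @compatible_concave f (val nu) (pos x (val nu)) (pos x (val nu) + eps)
  (pos x (val nu) + s) fS p0 _ _ sl.
rewrite hpoint_pos (epsP eps); last by rewrite lexx ltW.
rewrite lerDl lerD2l => /(_ (ltW eps0) s_ge).
have -> : pos x (val nu) + s - (pos x (val nu) + eps) = s - eps by ring.
have -> : pos x (val nu) + eps - pos x (val nu) = eps by ring.
have -> : pos x (val nu) + s - pos x (val nu) = s by ring.
by move=> conc; rewrite -(ler_pM2r eps0); lra.
Qed.

(** Lower semicontinuity of the indices of the slopes in the supremum norm, up
    to an additive constant [c]: if the index of [g] were smaller than that of
    [f], then [f - g] would grow by at least [d] over the distance [d]. *)
Lemma slope_index_le f g x (nu : tangent x) (i j : 'I_r.+1) (d eps : R) :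
  compatible S g -> 0 < d -> pos x (val nu) + d <= len (val nu).1 ->
  f (hpoint (val nu) (pos x (val nu) + d))
    = f x + (ss_slope S (val nu) i)%:~R * d ->
  slope g nu = ss_slope S (val nu) j ->
  (exists c, forall y, `|f y - (g y + c)| <= eps) -> 2 * eps < d -> (i <= j)%N.
Proof.
move=> gS d0 dl fE gE [c fg] eps_lt.
have := compatible_le_tangent (s := d) gS (ltW d0) dl; rewrite gE => le_g.
rewrite -(ss_slope_le (val nu)) leNgt; apply/negP => lt_ji.
have lt_R : (ss_slope S (val nu) j)%:~R + 1 <= (ss_slope S (val nu) i)%:~R :> R.
  by rewrite -[1]/(1%:~R) -intrD ler_int; lia.
have := fg x; have := fg (hpoint (val nu) (pos x (val nu) + d)).
rewrite fE !ler_norml => /andP[a1 a2] /andP[a3 a4].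
have : ((ss_slope S (val nu) j)%:~R + 1) * d <= (ss_slope S (val nu) i)%:~R * d.
  by rewrite ler_wpM2r // ltW.
lra.
Qed.

(** The index of the slope at [x] in the direction [nu] is at least the index
    past the point at distance [d], plus the rank at that point. *)
Lemma slope_index_drop f x (nu : tangent x) (i : 'I_r.+1) (d : R) (k : int) :
  compatible S f -> slope f nu = ss_slope S (val nu) i ->
  0 < d -> pos x (val nu) + d < len (val nu).1 ->
  0 <= k <= slope_rank S (slopes f (hpoint (val nu) (pos x (val nu) + d))) ->
  exists (nu' : tangent (hpoint (val nu) (pos x (val nu) + d))) (i' : 'I_r.+1),
    [/\ val nu' = val nu, slope f nu' = ss_slope S (val nu) i'
      & i'%:Z + k <= i%:Z].
Proof.
move=> fS fi d0 dl k_le; have /andP[p0 _] := pos_bounds nu.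
have inner : 0 < pos x (val nu) + d < len (val nu).1 by lra.
have [nu' [nu2 [i' [j [nuE nu2E fi' fj le_ij]]]]] := index_drop fS inner k_le.
exists nu', i'; split => //; apply: le_trans le_ij _; rewrite lez_nat.
rewrite -(ss_slope_le (val nu)) -(ler_int R) -(ler_pM2r d0).
have := compatible_le_tangent (nu := nu) fS (ltW d0) (ltW dl); rewrite fi.
have := compatible_le_tangent (nu := nu2) fS (ltW d0).
rewrite fj nu2E pos_opposite // hpoint_opposite /=.
have -> : len (val nu).1 - (len (val nu).1 - (pos x (val nu) + d) + d) =
  pos x (val nu) by ring.
rewrite hpoint_pos rmorphN /=.
have -> : len (val nu).1 - (pos x (val nu) + d) + d <= len (val nu).1 by lra.
by move=> /(_ isT); lra.
Qed.

(** A rational function is affine near [x] in all directions at once. *)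
Lemma slope_neighborhood f x : RatG f ->
  exists2 d : R, 0 < d & forall nu : tangent x,
    pos x (val nu) + d <= len (val nu).1 /\
    forall u, 0 <= u <= d ->
      f (hpoint (val nu) (pos x (val nu) + u)) = f x + (slope f nu)%:~R * u.
Proof.
move=> fR; have /choice[eps epsP] := fun nu : tangent x => slopeP nu fR.
exists (\big[Num.min/1]_nu eps nu).
  by apply: lt_bigmin => // nu _; have [] := epsP nu.
move=> nu; have [_ le_len fE] := epsP nu.
have le_eps : \big[Num.min/1]_nu eps nu <= eps nu by apply: bigmin_le_cond.
split; first by apply: le_trans le_len; rewrite lerD2l.
by move=> u /andP[u0 ud]; apply: fE; rewrite u0 (le_trans ud).
Qed.

End CompatibleFunctions.

(** * Compactness *)

Lemma ultra_fmap (T T' : Type) (u : T -> T') (U : set_system T) :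
  UltraFilter U -> UltraFilter (u @ U).
Proof.
move=> ultraU; split; first exact: fmap_proper_filter.
move=> W properW leW; apply/seteqP; split=> // A WA.
have [//|UA] := in_ultra_setVsetC (u @^-1` A) ultraU.
have /leW/(filterI WA) : (u @ U) (~` A) by [].
by rewrite setICr => /filter_not_empty.
Qed.

(** Finitely many bounded sequences have a common limit point: take limits along
    an ultrafilter finer than the neighborhoods of infinity. *)
Lemma finite_bolzano_weierstrass (R : realType) (J : finType)
    (a : J -> nat -> R) (K : J -> R) : (forall j n, `|a j n| <= K j) ->
  exists l : J -> R, forall eps : R, 0 < eps -> forall N : nat,
    exists2 n, (N <= n)%N & forall j, `|a j n - l j| <= eps.
Proof.
move=> aK; have [U [ultraU leU]] := @ultraFilterLemma nat \oo _.
have /choice[l al] j : exists l : R, a j @ U --> l.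
  have := @segment_compact R (- K j) (K j); rewrite compact_ultra.
  have Ubd : U (a j @^-1` `[- K j, K j]).
    by apply: filterS filterT => n _; rewrite /= in_itv /= -ler_norml.
  by move=> /(_ (a j @ U) (ultra_fmap (a j) ultraU) Ubd)[l [_ ?]]; exists l.
exists l => eps eps0 N.
have : U [set n | (N <= n)%N /\ forall j, `|a j n - l j| <= eps].
  apply: filterI; first by apply: leU; exact: nbhs_infty_ge.
  apply: filter_forall => j.
  have /cvgrPdist_le/(_ eps eps0) := al j.
  by apply: filterS => n; rewrite distrC.
by move=> /filter_ex[n [? ?]]; exists n.
Qed.

Section Compactness.
Variables (R : realType) (G : metric_graph R) (r : nat).
Variable S : slope_structure G r.
Implicit Types (e : edge G) (f g : gpoint G -> R) (u w : vertex G).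

Lemma compatible_edge_bounded e : exists K : R, forall f, compatible S f ->
  `|f (inl (src e)) - f (inl (tgt e))| <= K.
Proof.
exists (`|(edge_slope S e r)%:~R * len e|
  + \sum_(j < r) `|(edge_slope S e j.+1 - edge_slope S e j)%:~R| * len e).
move=> f fS; have [tau [tau_bd tauP]] := compatible_edge_form e fS.
have l0 := ltW (len_gt0 e).
have := tauP (len e); rewrite lexx l0 on_edge_tgt // => ->//.
rewrite /ramp_sum -addrA opprD addrA subrr sub0r normrN.
apply: le_trans (ler_normB _ _) _; rewrite lerD2l.
apply: le_trans (ler_norm_sum _ _ _) _; apply: ler_sum => j _.
rewrite normrM ler_wpM2l //.
by have /andP[t0 tl] := tau_bd j; rewrite ramp_ge // ger0_norm; lra.
Qed.

(** By connectedness, the differences between the values at two vertices are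
    bounded uniformly in the compatible function. *)
Lemma compatible_vertex_bounded w u : exists K : R, forall f, compatible S f ->
  `|f (inl u) - f (inl w)| <= K.
Proof.
have /connectP[p + ->] := graph_connected w u.
elim: p w => [|z p IH] w /=; first by exists 0 => f _; rewrite subrr normr0.
move=> /andP[/existsP[e adj] /IH[K fK]].
have [K' fK'] := compatible_edge_bounded e.
exists (K + K') => f fS; have := fK f fS; have := fK' f fS.
have -> : `|f (inl (src e)) - f (inl (tgt e))| = `|f (inl z) - f (inl w)|.
  by case/orP: adj => /andP[/eqP-> /eqP->] //; rewrite distrC.
move=> le1 le2; apply: le_trans (lerD le2 le1).
by rewrite -[X in `|X|](subrKA (f (inl z))) ler_normD.
Qed.

(** A sequence in [M] has a limit point in [M] up to additive constants.  The
    terms, normalized to vanish at the vertex [w], are determined by their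
    values at the vertices and by the breakpoints of their ramp forms, which are
    finitely many bounded sequences of numbers. *)
Lemma admissible_compact D M (g : nat -> gpoint G -> R) :
  admissible S D M -> (forall n, M (g n)) ->
  exists2 f, M f & forall eps : R, 0 < eps -> forall N : nat,
    exists2 n, (N <= n)%N & exists c, forall x, `|f x - (g n x + c)| <= eps.
Proof.
move=> [[_ _ M_shift] _ M_closed M_compat _] gM.
have gS n : compatible S (g n) by have [] := M_compat _ (gM n).
have /card_gt0P[e0 _] := has_edge G.
pose w := src e0.
have /choice[K gK] : forall u, exists K : R, forall f, compatible S f ->
    `|f (inl u) - f (inl w)| <= K by move=> u; apply: compatible_vertex_bounded.
have /choice[tau tauP] : forall en : edge G * nat, exists tau : nat -> R,
    (forall j, 0 <= tau j <= len en.1) /\ forall s, 0 <= s <= len en.1 ->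
      g en.2 (on_edge en.1 s) =
      ramp_sum r (edge_slope S en.1) (g en.2 (inl (src en.1))) tau s.
  by move=> [e n]; apply: compatible_edge_form.
pose J : finType := (vertex G + edge G * 'I_r.+1)%type.
pose a (j : J) n := match j with
  | inl u => g n (inl u) - g n (inl w)
  | inr (e, j) => tau (e, n) j
  end.
have [|l lP] := @finite_bolzano_weierstrass R J a
  (fun j => match j with inl u => K u | inr (e, _) => len e end).
  move=> [u|[e j]] n; first exact: gK.
  by have [/(_ j)/= /andP[t0 tl] _] := tauP (e, n); rewrite ger0_norm.
pose A u := l (inl u); pose T e j := l (inr (e, inord j)).
pose F e s := ramp_sum r (edge_slope S e) (A (src e)) (T e) s.
pose f (x : gpoint G) := match x with
  | inl u => A u
  | inr p => F (val p).1 (val p).2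
  end.
pose C := 1 + \sum_(e : edge G)
  (1 + \sum_(j < r) `|(edge_slope S e j.+1 - edge_slope S e j)%:~R : R|).
have sum_ge0 e :
    0 <= \sum_(j < r) `|(edge_slope S e j.+1 - edge_slope S e j)%:~R : R|.
  by apply: sumr_ge0.
have C_ge e :
    1 + \sum_(j < r) `|(edge_slope S e j.+1 - edge_slope S e j)%:~R| <= C.
  rewrite /C (bigD1 e) //= addrCA lerDl addr_ge0 // sumr_ge0 // => e' _.
  by rewrite addr_ge0.
have C1 : 1 <= C by rewrite lerDl sumr_ge0 // => e _; rewrite addr_ge0.
have C0 : 0 < C by apply: lt_le_trans C1.
have approx eps : 0 < eps -> forall N : nat, exists2 n, (N <= n)%N &
    exists c, (forall u, `|A u - (g n (inl u) + c)| <= eps) /\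
      forall e s, 0 <= s <= len e -> `|F e s - (g n (on_edge e s) + c)| <= eps.
  move=> eps0 N; have [|n Nn ln] := lP (eps / C) _ N; first exact: divr_gt0.
  exists n => //; exists (- g n (inl w)).
  have A_le u : `|A u - (g n (inl u) - g n (inl w))| <= eps / C.
    by rewrite distrC; apply: (ln (inl u)).
  split=> [u|e s s_bd].
    by apply: le_trans (A_le u) _; rewrite ler_pdivrMr // ler_peMr // ltW.
  have [_ /(_ s s_bd)/= ->] := tauP (e, n).
  have -> : ramp_sum r (edge_slope S e) (g n (inl (src e))) (tau (e, n)) s
      - g n (inl w) = ramp_sum r (edge_slope S e)
        (g n (inl (src e)) - g n (inl w)) (tau (e, n)) s.
    by rewrite /ramp_sum; ring.
  apply: le_trans (ramp_sum_lipschitz _ _ (A_le _) _) _.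
    move=> j jr; rewrite distrC; have := ln (inr (e, inord j)).
    by rewrite /= inordK // ltnS ltnW.
  rewrite mulrCA ler_piMr ?(ltW eps0) // ler_pdivrMr // mul1r.
  exact: C_ge.
(* at the head of [e] this is the continuity of [f], which holds by passing to
   the limit *)
have fF e s : 0 <= s <= len e -> f (on_edge e s) = F e s.
  move=> /[dup] s_bd /andP[s0 sl].
  have ends : forall u, on_edge e s = inl u -> f (on_edge e s) = F e s.
    move=> u eu; rewrite eu /=; apply/eqP; rewrite -subr_eq0 -normr_le0.
    apply/ler_addgt0Pr => eps eps0; rewrite add0r.
    have [|n _ [c [/(_ u) Ac /(_ e s s_bd) Fc]]] := approx (eps / 2) _ 0%N.
      by rewrite divr_gt0.
    rewrite eu in Fc; move: Ac Fc; rewrite !ler_norml; lra.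
  have [s_le|s_gt] := leP s 0.
    by apply: (ends (src e)); apply: on_edge_src.
  have [s_ge|s_lt] := leP (len e) s.
    by apply: (ends (tgt e)); apply: on_edge_tgt.
  by have [|p -> /= ->] := @on_edge_inner _ _ e s; first by rewrite s_gt.
have f_near eps : 0 < eps -> forall N : nat, exists2 n, (N <= n)%N &
    exists c, forall x, `|f x - (g n x + c)| <= eps.
  move=> eps0 N; have [n Nn [c [Ac Fc]]] := approx eps eps0 N.
  exists n => //; exists c => -[u|p]; first exact: Ac.
  have /andP[p0 pl] := valP p.
  have -> : inr p = on_edge (val p).1 (val p).2 :> gpoint G.
    have [|q -> qE] := @on_edge_inner _ _ (val p).1 (val p).2.
      by rewrite p0.
    by congr inr; apply: val_inj; rewrite /= qE; apply: surjective_pairing.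
  by rewrite fF ?Fc // !ltW.
exists f => //; apply: M_closed => [e|eps eps0]; last first.
  have [n _ [c fc]] := f_near eps eps0 0%N.
  by exists (fun x => g n x + c) => //; apply: M_shift.
have [n [t [m [t0 tn t_lt t_aff]]]] := pw_affine_subdivision
  (pw_affine_ramp_sum r (edge_slope S e) (A (src e)) (T e) (ltW (len_gt0 e))).
exists n, t, m; split => // i lt_i s /andP[ts st].
have ti0 := subdivision_le t_lt (i := 0) (j := i) (ltnW lt_i).
have tin : t i.+1 <= t n by apply: (subdivision_le t_lt); rewrite lt_i leqnn.
rewrite !fF; [apply: t_aff; rewrite ?ts| |] => //; have := t_lt i lt_i; lra.
Qed.

End Compactness.

(** * Divisors controlling a jump *)

Lemma sum_count_mem (T : eqType) (s : seq T) :
  (\sum_(x <- undup s) count_mem x s)%N = size s.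
Proof.
under eq_bigr => x _ do rewrite -sum1_count big_mkcond /=.
rewrite exchange_big /= -sum1_size !big_seq; apply: eq_bigr => y ys.
rewrite -big_mkcond /= sum1_count (eq_count (a2 := pred1 y)).
  by rewrite count_uniq_mem ?undup_uniq // mem_undup ys.
by move=> x /=; rewrite eq_sym.
Qed.

Lemma divisor_of_seq (R : realType) (G : metric_graph R) (s : seq (gpoint G)) :
  exists E : divisor G,
    (forall x, E x = (count_mem x s)%:Z) /\ deg E = (size s)%:Z.
Proof.
pose E : divisor G := [fsfun x in seq_fset tt s => (count_mem x s)%:Z].
have EE x : E x = (count_mem x s)%:Z.
  rewrite fsfun_fun seq_fsetE; case: ifP => // /negbT xs.
  by apply/esym/eqP; rewrite eqz_nat; apply/eqP/count_memPn.
exists E; split => //; rewrite /deg -(sum_count_mem s) -natz natr_sum.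
rewrite (perm_big (undup s)) /=; last first.
  apply: uniq_perm; rewrite ?fset_uniq ?undup_uniq // => x.
  by rewrite mem_undup mem_finsupp EE eqz_nat -lt0n -has_count has_pred1.
by apply: eq_bigr => x _; rewrite EE natz.
Qed.

Section MainArgument.
Variables (R : realType) (G : metric_graph R) (r : nat).
Variables (D : divisor G) (S : slope_structure G r) (M : set (gpoint G -> R)).
Hypothesis M_admissible : admissible S D M.
Implicit Types (s : seq (gpoint G)) (x : gpoint G).

(** An effective divisor is represented by the sequence of its points.  The
    function [f] dominates it if its rank at each point is at least the
    multiplicity of this point. *)
Definition dominates (f : gpoint G -> R) s : Prop :=
  forall x, (count_mem x s)%:Z <= slope_rank S (slopes f x).

Lemma admissible_dominates s : size s = r -> exists2 f, M f & dominates f s.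
Proof.
move=> s_size; have [E [EE degE]] := divisor_of_seq s.
have [_ _ _ _ /(_ E)[]] := M_admissible.
- by move=> x; rewrite EE.
- by rewrite degE s_size.
- by move=> f Mf [domf _]; exists f => // x; rewrite -EE.
Qed.

Variable v : gpoint G.
Implicit Types a b : cube r (tangent v).

(** Every function of [M] which dominates [s] has the slopes [s_a] at [v]; the
    multiplicity of [v] in [s] is the rank of [a]. *)
Definition controls s a : Prop :=
  [/\ size s = r, (count_mem v s)%:Z = rank_at S a
    & forall f, M f -> dominates f s -> slopes f v = slope_vector S a].

Lemma M_compatible f : M f -> compatible S f.
Proof. by move=> Mf; have [_ _ _ /(_ f Mf)[]] := M_admissible. Qed.

Lemma controls_origin a : jump (@rank_at _ _ _ S v) a -> rank_at S a = r%:Z ->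
  controls (nseq r v) a.
Proof.
move=> ja ra; split; rewrite ?size_nseq ?count_nseq ?ra //= ?eqxx ?mul1n //.
move=> f /M_compatible fS /(_ v); rewrite count_nseq /= eqxx mul1n.
have [b jb ->] := compatibleP v fS; rewrite slope_rank_vector => rb.
congr slope_vector; have rP := rank_atP S v.
apply: (jump_uniq (c := cube_min a b) rP jb ja).
- by move=> i; rewrite cube_minE geq_minr.
- by move=> i; rewrite cube_minE geq_minl.
- exact: le_trans (rank_le_width rP _) rb.
- by rewrite ra; apply: rank_le_width.
Qed.

(** The limit argument: one copy of [v] is replaced by a point close to [v] in
    the direction [nu]. *)
Lemma controls_step a b (nu : tangent v) s :
  jump (@rank_at _ _ _ S v) a -> jump (@rank_at _ _ _ S v) b ->
  rank_at S b = rank_at S a + 1 -> cube_le b a -> (b nu < a nu)%N ->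
  controls s b -> exists s', controls s' a.
Proof.
move=> ja jb rab le_ba lt_nu [s_size s_v s_ctrl]; have rP := rank_atP S v.
have ra0 : 0 <= rank_at S a by case: ja.
have vs : v \in s by rewrite -has_pred1 has_count; lia.
have /andP[p0 pl] := pos_bounds nu.
set h := val nu in p0 pl *; set p := pos v h in p0 pl *.
pose l := len h.1 - p; have l0 : 0 < l by rewrite subr_gt0.
pose d (n : nat) := l / n.+2%:R.
have d0 n : 0 < d n by rewrite divr_gt0.
have dl n : d n < l by rewrite ltr_pdivrMr // ltr_pMr // ltr1n.
pose y n := hpoint h (p + d n).
have yv n : (y n == v) = false.
  apply/eqP => yn; have : p + d n = p.
    apply: (@hpoint_inj _ _ h); rewrite ?p0 ?pl //.
      by have := d0 n; have := dl n; rewrite /l; lra.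
    by rewrite [LHS]yn hpoint_pos.
  by have := d0 n; lra.
pose s' n := y n :: rem v s.
have s'_size n : size (s' n) = r.
  by rewrite /= size_rem // prednK //; case: (s) vs.
have count_v n : (count_mem v (s' n))%:Z = rank_at S a.
  rewrite -[count_mem v (s' n)]/((y n == v) + count_mem v (rem v s))%N.
  rewrite yv add0n count_rem vs [pred1 v v]eqxx subn1.
  by move: s_v; case: (count_mem v s) => [|k]; lia.
apply: contrapT => /forallNP no_ctrl.
have /choice[g gP] : forall n, exists g,
    [/\ M g, dominates g (s' n) & slopes g v <> slope_vector S a].
  move=> n; apply: contrapT => no_g; apply: (no_ctrl (s' n)); split => //.
  by move=> g Mg dg; apply: contrapT => ng; apply: no_g; exists g.
have [|f Mf f_near] := admissible_compact (g := g) M_admissible.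
  by move=> n; have [] := gP n.
have fS := M_compatible Mf; have [fR _] := fS.
have gS n : compatible S (g n) by have [/M_compatible] := gP n.
(* semicontinuity in all directions at [x] at once *)
have semi x : exists2 e : R, 0 < e & forall n c,
    (forall z, `|f z - (g n z + c)| <= e) ->
    forall (af ag : cube r (tangent x)), slopes f x = slope_vector S af ->
      slopes (g n) x = slope_vector S ag -> cube_le af ag.
  have [e e0 eP] := slope_neighborhood x fR.
  exists (e / 3); first by lra.
  move=> n c fg af ag fE gE mu; have [le_len affE] := eP mu.
  apply: (@slope_index_le _ _ _ S f (g n) x mu _ _ e (e / 3)) => //.
  - by rewrite affE ?(slope_index _ fE) // lexx ltW.
  - exact: slope_index.
  - by exists c.
  - by lra.
have [af jaf fE] := compatibleP v fS.
have [n [ag [jag gE le_fg lt_fg]]] : exists n ag,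
    [/\ jump (@rank_at _ _ _ S v) ag, slopes (g n) v = slope_vector S ag,
        cube_le af ag & (af nu < ag nu)%N].
  (* For [y n] within [e / 2] of [v] and [g n] within [e / 5] of [f], the
     segment from [y n] to distance [e] is long enough for semicontinuity at
     [y n], while the index of [g n] drops at [y n]. *)
  have [e e0 eP] := slope_neighborhood v fR.
  have [e' e'0 e'P] := semi v.
  pose eps := Num.min e' (e / 5).
  have eps0 : 0 < eps by rewrite lt_min e'0; lra.
  have eps_le : eps <= e / 5 by rewrite ge_min lexx orbT.
  have eps_le' : eps <= e' by rewrite ge_min lexx.
  have [n Nn [c fg]] := f_near eps eps0 (Num.bound (2 * l / e)).
  have [ag jag gE] := compatibleP v (gS n).
  exists n, ag; split=> //.
    by apply: (e'P n c) => // z; apply: le_trans (fg z) eps_le'.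
  have dn : d n < e / 2.
    rewrite ltr_pdivrMr // -ltr_pdivrMl; last by lra.
    have -> : (e / 2)^-1 * l = 2 * l / e by rewrite invfM invrK; ring.
    apply: lt_le_trans (archi_boundP _) _.
      by rewrite divr_ge0 ?ltW // mulr_gt0.
    by rewrite ler_nat; apply: leq_trans Nn _; rewrite ltnW // ltnW.
  have [_ domg _] := gP n.
  have [||nu' [i' [nuE' gi' le_i']]] :=
    @slope_index_drop _ _ _ S (g n) v nu (ag nu) (d n) 1 (gS n)
      (slope_index nu gE) (d0 n).
  - by have := dl n; rewrite /l -/h -/p; lra.
  - by rewrite ler01; apply: le_trans (domg (y n)); rewrite /= eqxx.
  suff le_i : (af nu <= i')%N.
    by rewrite -lez_nat; apply: le_trans le_i'; rewrite -addn1 PoszD lerD2r.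
  rewrite -/h -/p in nu' nuE' gi' *.
  have [le_len affE] := eP nu; rewrite -/h -/p in le_len affE.
  have posE : pos (y n) h = p + d n.
    by rewrite pos_hpoint //; have := d0 n; have := dl n; rewrite /l; lra.
  apply: (@slope_index_le _ _ _ S f (g n) (y n) nu' _ _ (e - d n) eps) => //.
  - by lra.
  - by rewrite nuE' posE; lra.
  - rewrite nuE' posE; have -> : p + d n + (e - d n) = p + e by ring.
    rewrite /y !affE; [|have := d0 n; lra|lra].
    by rewrite (slope_index nu fE); ring.
  - by rewrite nuE'.
  - by exists c.
  - by lra.
have s_dom : dominates f s.
  move=> x; have [->|xv] := eqVneq x v.
    rewrite s_v fE slope_rank_vector rab.
    suff : rank_at S ag < rank_at S af.
      have [_ /(_ v)] := gP n; rewrite count_v gE slope_rank_vector; lia.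
    apply: (rank_jump_lt rP jaf le_fg) => eq_fg.
    by rewrite eq_fg ltnn in lt_fg.
  have [e e0 eP] := semi x.
  have [k _ [c fg]] := f_near e e0 0%N.
  have [bf _ bfE] := compatibleP x fS; have [bg _ bgE] := compatibleP x (gS k).
  have [_ /(_ x) dom_k _] := gP k.
  rewrite bfE slope_rank_vector.
  apply: le_trans (rank_le (rank_atP S x) (eP k c fg bf bg bfE bgE)).
  rewrite -slope_rank_vector -bgE; apply: le_trans dom_k.
  by rewrite lez_nat /= count_rem vs /= (eq_sym v x) (negPf xv) subn0 leq_addl.
have afE : af = b by apply/(@slope_vector_inj _ _ _ S); rewrite -fE s_ctrl.
have [_ domg []] := gP n; rewrite gE; congr slope_vector.
rewrite {}afE in le_fg lt_fg.
have tr : ((b nu).+1 < r.+1)%N by have := ltn_ord (a nu); lia.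
have upd_b : rank_at S (upd b nu (Ordinal tr)) = rank_at S a.
  by case: jb => _ -> //; lia.
apply: (jump_uniq (c := upd b nu (Ordinal tr)) rP jag ja).
- exact: upd_le.
- exact: upd_le.
- by have := domg v; rewrite upd_b count_v gE slope_rank_vector.
- by rewrite upd_b.
Qed.

Lemma exists_controls a (nu : tangent v) : jump (@rank_at _ _ _ S v) a ->
  exists s, controls s a.
Proof.
have rP := rank_atP S v.
have [n] : exists n : nat, r%:Z - rank_at S a = n%:Z.
  by exists `|r%:Z - rank_at S a|%N; have := rank_le_width rP a; lia.
elim: n a => [|n IH] a an ja.
  by exists (nseq r v); apply: controls_origin => //; lia.
have [|b [i [jb rab le_ba lt_i]]] := jump_pred rP nu ja; first by lia.
have [|s sb] := IH b _ jb; first by lia.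
exact: controls_step lt_i sb.
Qed.

End MainArgument.

Theorem theorem1p2 (R : realType) (G : metric_graph R) (r : nat)
    (D : divisor G) (S : slope_structure G r) (M : set (gpoint G -> R))
    (M_admissible : admissible S D M)
    (v : gpoint G) (a : cube r (tangent v))
    (a_jump : jump (rank_at S (x := v)) a) :
  exists f : gpoint G -> R, M f /\ slopes f v = slope_vector S a.
Proof.
have [nu _|no_nu] := pickP (xpredT : pred (tangent v)).
  have [s [s_size _ s_ctrl]] := exists_controls M_admissible nu a_jump.
  have [f Mf f_dom] := admissible_dominates M_admissible s_size.
  by exists f; split => //; apply: s_ctrl.
have [f Mf _] := admissible_dominates M_admissible (size_nseq r v).
by exists f; split => //; apply/ffunP => nu; have := no_nu nu.
Qed.
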